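(* Let $\gamma:[0,1]\to\mathbb{R}^{d}$ be a rationally non-degenerate analytic curve of order $\kappa\in\mathbb{N}$ (so $\kappa<\infty$). Then there exists a sequence $\{\rho_{n}\}_{n=1}^{\infty}$ satisfying $n^{\kappa}\leq\rho_{n}\leq n^{(\kappa+1)^{2}}$ for all $n\in\mathbb{N}$ such that the sequence of probability measures \[ \mu_{n}=\frac{1}{n}\sum_{k=1}^{n}\delta_{\pi(\rho_{n}\gamma(k/n))} \] on $\mathbb{T}^{d}=\mathbb{R}^{d}/\mathbb{Z}^{d}$ does not equidistribute.
   Context: $\pi:\mathbb{R}^{d}\to\mathbb{R}^{d}/\mathbb{Z}^{d}$ is the natural projection. A sequence of probability measures $\mu_n$ on $\mathbb{T}^d$ equidistributes if $\lim_{n\to\infty}\mu_{n}(f)=\int_{\mathbb{T}^{d}}f\,d\mathbf{x}$ for all continuous $f$ on $\mathbb{T}^{d}$, where $d\mathbf{x}$ is normalized Haar measure. ''Analytic'' means real analytic (on a neighbourhood of $[0,1]$). For a smooth curve $\gamma:[0,1]\to\mathbb{R}^{d}$ and $j\in\mathbb{N}$, $\gamma^{(j)}$ denotes the componentwise $j$-th derivative. $\gamma$ is rationally non-degenerate of order $\kappa\in\mathbb{N}\cup\{\infty\}$ if $\kappa=\sup\{j\in\mathbb{N}: \text{for every }\mathbf{h}\in\mathbb{Z}^{d}\setminus\{\mathbf{0}\},\ t\mapsto\langle\mathbf{h},\gamma^{(j)}(t)\rangle\text{ is not identically zero}\}$. *)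

(* Defs.v *)
From HB Require Import structures.
From mathcomp Require Import all_boot all_order all_algebra.
From mathcomp Require Import all_classical all_reals all_analysis.
Set Implicit Arguments. Unset Strict Implicit. Unset Printing Implicit Defensive.
Import Order.TTheory GRing.Theory Num.Theory.
Import numFieldNormedType.Exports.
Local Open Scope classical_set_scope.
Local Open Scope ring_scope.

Section Defs.
Variable R : realType.

Definition analytic_at (f : R -> R) (x0 : R) : Prop :=
  exists r : R, 0 < r /\ exists a : nat -> R,
    forall x, `|x - x0| < r ->
      (fun n : nat => \sum_(0 <= k < n) a k * (x - x0) ^+ k) @ \oo --> f x.

Definition analytic_curve (d : nat) (g : R -> 'rV[R]_d) : Prop :=
  exists U : set R, open U /\ `[0%R, 1%R] `<=` U /\
    forall (i : 'I_d) x, U x -> analytic_at (fun t => g t ord0 i) x.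

Definition curve_deriv (d : nat) (j : nat) (g : R -> 'rV[R]_d) (t : R)
  : 'rV[R]_d := \row_(i < d) derive1n j (fun s => g s ord0 i) t.

Definition nondeg_at (d : nat) (g : R -> 'rV[R]_d) (j : nat) : Prop :=
  forall h : 'rV[int]_d, h != 0 ->
    exists t : R, t \in `[0%R, 1%R] /\
      \sum_(i < d) (h ord0 i)%:~R * curve_deriv j g t ord0 i != 0.

(* rationally non-degenerate of (finite) order kappa: kappa is the supremum
   (= maximum) of {j in N | nondeg_at g j}, with N = {1,2,...}. *)
Definition rat_nondeg_order (d : nat) (g : R -> 'rV[R]_d) (kappa : nat) : Prop :=
  (0 < kappa)%N /\ nondeg_at g kappa /\
  forall j : nat, (0 < j)%N -> nondeg_at g j -> (j <= kappa)%N.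

(* continuous functions on T^d = continuous Z^d-periodic functions on R^d *)
Definition periodic (d : nat) (F : 'rV[R]_d -> R) : Prop :=
  forall (x : 'rV[R]_d) (v : 'rV[int]_d), F (x + map_mx intr v) = F x.

Fixpoint cube_int (m : nat) (G : (nat -> R) -> R) : R :=
  match m with
  | 0 => G (fun _ => 0)
  | m'.+1 => Rintegral (@lebesgue_measure R) `[0%R, 1%R]
      (fun t => cube_int m' (fun x => G (fun i => if i == m' then t else x i)))
  end.

(* integral against normalized Haar measure of T^d = integral over [0,1]^d *)
Definition torus_int (d : nat) (F : 'rV[R]_d -> R) : R :=
  cube_int d (fun x => F (\row_(i < d) x (nat_of_ord i))).

Definition mu (d : nat) (rho : nat -> R) (g : R -> 'rV[R]_d) (n : nat)
  (F : 'rV[R]_d -> R) : R :=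
  (n%:R)^-1 * \sum_(1 <= k < n.+1) F (rho n *: g (k%:R / n%:R)).

Definition equidistributes (d : nat) (m : nat -> ('rV[R]_d -> R) -> R) : Prop :=
  forall F : 'rV[R]_d -> R, continuous F -> periodic F ->
    (fun n => m n F) @ \oo --> torus_int F.

End Defs.

(* Main.v *)
Require Import Defs.
From HB Require Import structures.
From mathcomp Require Import all_boot all_order all_algebra.
From mathcomp Require Import all_classical all_reals all_analysis.
From mathcomp Require Import ring lra zify.
Import Order.TTheory GRing.Theory Num.Theory.
Import numFieldNormedType.Exports.
Local Open Scope classical_set_scope.
Local Open Scope ring_scope.

(** Maximality of [kappa] yields an integer vector [h <> 0] with
    [<h, gamma^(kappa+1)> = 0], so [<h, gamma>] is on [[0, 1]] a polynomial [p]
    of degree at most [kappa].  With [rho_n = n^kappa q], the number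
    [rho_n p(k/n)] is an integer combination of the [kappa + 1] reals
    [q p_j n^(kappa-j)], with coefficients [k^j <= n^kappa].  Dirichlet's
    simultaneous approximation theorem with tolerance [1/(C n^kappa)] gives
    [q <= (C n^kappa)^(kappa+1)] making all [rho_n p(k/n)] close to integers,
    and for [n >= C^(kappa+1)] this keeps [rho_n <= n^((kappa+1)^2)].  Hence
    [cos (2 pi <h, x>)], whose integral vanishes, has [mu_n]-average at least
    [1/2]. *)

(** * Termwise differentiation of power series *)

Section analytic.
Variable R : realType.
Implicit Types (f : R -> R) (a : nat -> R) (x y z : R) (n : nat).

(** Each of the [n.+1] copies of [z ^+ n] is at most [z ^+ i] with [i <= n], and the geometric sum
    is at most [(1 - z)^-1]. This controls the factor that differentiating a power series
    produces. *)
Lemma natrM_expr_le z n : 0 <= z < 1 -> n.+1%:R * z ^+ n <= (1 - z)^-1.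
Proof.
move=> /andP[z0 z1].
have z1' : 0 < 1 - z by rewrite subr_gt0.
rewrite -[leRHS]mul1r ler_pdivlMr//.
have -> : n.+1%:R * z ^+ n = \sum_(i < n.+1) z ^+ n.
  by rewrite sumr_const card_ord mulr_natl.
apply: (@le_trans _ _ ((\sum_(i < n.+1) z ^+ i) * (1 - z))).
  rewrite ler_wpM2r ?(ltW z1')//; apply: ler_sum => i _.
  by rewrite ler_wiXn2l ?(ltW z1)// -ltnS.
have := subrX1 z n.+1; set S := \sum_(i < n.+1) _ => e.
have -> : S * (1 - z) = 1 - z ^+ n.+1 by rewrite -[RHS]opprB e; ring.
by rewrite gerBl exprn_ge0.
Qed.

(** Put [y] strictly between [|z|] and [|x|]. The ratio [|z| / y] absorbs the factor [n.+1], the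
    terms [a n * x ^+ n] are bounded since their series converges, and [y / |x|] remains as the
    ratio of a dominating geometric series. *)
Lemma is_cvg_pseries_diffs_inside a x z :
  cvgn (pseries a x) -> `|z| < `|x| -> cvgn (pseries (pseries_diffs a) z).
Proof.
move=> Cx zx; have [K [Kreal Kf]] := cvg_series_bounded Cx.
have x0 : 0 < `|x| by exact: le_lt_trans zx.
pose y := (`|z| + `|x|) / 2.
have zy : `|z| < y by rewrite /y; lra.
have yx : y < `|x| by rewrite /y; lra.
have y0 : 0 < y by exact: le_lt_trans zy.
have t01 : 0 <= `|z| / y < 1.
  by rewrite divr_ge0 ?(ltW y0)//= ltr_pdivrMr// mul1r.
set C := (`|K| + 1) / `|x| / (1 - `|z| / y).
have C0 : 0 <= C.
  apply: mulr_ge0; first by rewrite divr_ge0// addr_ge0.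
  by rewrite invr_ge0 subr_ge0 ltW//; case/andP: t01.
apply: normed_cvg.
apply: (@series_le_cvg _ _ (geometric C (y / `|x|))) => [n|n|n|].
- exact: normr_ge0.
- by rewrite /geometric/= mulr_ge0// exprn_ge0// divr_ge0// ltW.
- rewrite /geometric/= /pseries_diffs !normrM ger0_norm// normrX.
  have -> : `|z| ^+ n = (`|z| / y) ^+ n * y ^+ n.
    by rewrite -exprMn divfK// gt_eqF.
  have -> : n.+1%:R * `|a n.+1| * ((`|z| / y) ^+ n * y ^+ n) =
    `|a n.+1 * x ^+ n.+1| / `|x| * (n.+1%:R * (`|z| / y) ^+ n) * (y / `|x|) ^+ n.
    rewrite normrM normrX !exprMn !exprVn exprS.
    by field; rewrite !expf_neq0 ?gt_eqF.
  have y0' := ltW y0; rewrite ler_wpM2r ?exprn_ge0 ?divr_ge0//.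
  rewrite /C; apply: ler_pM => //.
  + by rewrite mulr_ge0// exprn_ge0//; case/andP: t01.
  + rewrite ler_wpM2r ?invr_ge0//; apply: Kf => //.
    by rewrite (le_lt_trans (ler_norm _))// ltrDl.
  + exact: natrM_expr_le.
- apply: is_cvg_geometric_series.
  by rewrite ger0_norm ?divr_ge0 ?(ltW y0)// ltr_pdivrMr// mul1r.
Qed.

(** The differentiated series converges on the same disc of radius [r], so it serves as the
    expansion of the derivative, and the argument can be iterated. *)
Lemma analytic_at_derive f x0 : analytic_at f x0 ->
  derivable f x0 1 /\ analytic_at (derive1 f) x0.
Proof.
move=> [r [r0 [a af]]].
have Ca z : `|z| < r -> cvgn (pseries a z).
  move=> zr; apply/cvg_ex; exists (f (z + x0)).
  by have := af (z + x0); rewrite addrK => /(_ zr).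
(* Termwise differentiation at [z] needs convergence of the series and of its first two formal
   derivatives at a point of larger modulus; the midpoint of [|z|] and [r] is such a point. *)
have between z : `|z| < r -> `|z| < `|(`|z| + r) / 2| < r.
  move=> zr; have := normr_ge0 z => z0.
  by rewrite [X in _ < X < _]ger0_norm; lra.
have Cd b : (forall z, `|z| < r -> cvgn (pseries b z)) ->
    forall z, `|z| < r -> cvgn (pseries (pseries_diffs b) z).
  move=> Cb z /between/andP[zk kr].
  by apply: is_cvg_pseries_diffs_inside zk; exact: Cb.
have df x : `|x - x0| < r ->
    is_derive x 1 f (limn (pseries (pseries_diffs a) (x - x0))).
  move=> xr; have /andP[zk kr] := between _ xr.
  have dS := @pseries_snd_diffs _ a _ _ (Ca _ kr) (Cd _ Ca _ kr)
    (Cd _ (Cd _ Ca) _ kr) zk.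
  apply: (@near_eq_is_derive _ _ _ ((fun z => limn (pseries a z)) \o (fun y => y - x0))).
    have /nbhs_ballP : nbhs x (ball x0 r).
      by apply: open_nbhs_nbhs; split; [exact: ball_open|rewrite -ball_normE/= distrC].
    move=> [e e0 xe]; apply/nbhs_ballP; exists e => // y /xe.
    rewrite -ball_normE/= distrC => yr; apply/cvg_lim => //; exact: af.
  have ds : is_derive x 1 (fun y : R => y - x0) 1.
    by apply: is_derive_eq; rewrite subr0.
  have := @is_derive1_comp _ _ _ x _ _ dS ds.
  by rewrite mulr1.
split; first by apply: (@ex_derive _ _ _ _ _ _ _ (df x0 _)); rewrite subrr normr0.
exists r; split => //; exists (pseries_diffs a) => x xr.
rewrite derive1E (@derive_val _ _ _ _ _ _ _ (df x xr)).
exact: Cd.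
Qed.

Lemma analytic_at_derive1n f x n : analytic_at f x -> analytic_at (derive1n n f) x.
Proof. by move=> fx; elim: n => // n /analytic_at_derive[]. Qed.

(** Induction on the order. The formula at order [m] has to hold on all of the open set [U], not at
    one point, for differentiation to pass it on to order [m.+1]. *)
Lemma derive1n_lincomb d (c : 'I_d -> R) (g : 'I_d -> R -> R) (U : set R) n :
  open U -> (forall i x, U x -> analytic_at (g i) x) ->
  forall x, U x ->
  let f := fun t => \sum_(i < d) c i * g i t in
  is_derive x 1 (derive1n n f) (derive1n n.+1 f x) /\
  derive1n n f x = \sum_(i < d) c i * derive1n n (g i) x.
Proof.
move=> oU ga x Ux f.
have df m :
    (forall y, U y -> derive1n m f y = \sum_(i < d) c i * derive1n m (g i) y) ->
    forall y, U y ->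
    is_derive y 1 (derive1n m f) (\sum_(i < d) c i * derive1n m.+1 (g i) y).
  move=> fE y Uy.
  apply: (@near_eq_is_derive _ _ _ (\sum_(i < d) c i \*: derive1n m (g i))).
    apply: filterS (open_nbhs_nbhs (conj oU Uy)) => z Uz.
    by rewrite fE// fct_sumE.
  apply: is_derive_sum => i.
  have [dg _] := analytic_at_derive _ _ (@analytic_at_derive1n _ _ m (ga i y Uy)).
  by apply: is_deriveZ; rewrite derive1nS derive1E; exact/derivableP.
have fE m : forall y, U y -> derive1n m f y = \sum_(i < d) c i * derive1n m (g i) y.
  elim: m => [//|m IH] y Uy; have H := df m IH y Uy.
  by rewrite derive1nS derive1E derive_val.
by split; [rewrite fE//; apply: df => //; exact: fE|exact: fE].
Qed.

End analytic.

(** * A vanishing derivative of order [n] forces a polynomial *)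

Section polynomial.
Variable R : realType.

Lemma is_derive_0_segment_cst (f : R -> R) (a b : R) :
  (forall t, t \in `[a, b] -> is_derive t 1 f 0) ->
  {in `[a, b], forall t, f t = f a}.
Proof.
move=> df t tab; have := tab; rewrite in_itv/= => /andP[at_ tb].
have sub u : u \in `[a, t] -> u \in `[a, b].
  by rewrite !in_itv/= => /andP[-> ut]; exact: le_trans ut tb.
have dft u : u \in `]a, t[ -> is_derive u 1 f ((fun=> 0) u).
  by move=> /subset_itv_oo_cc/sub/df.
have cf : {within `[a, t], continuous f}.
  by apply: derivable_within_continuous => u /sub/df ?; exact: ex_derive.
have [u _] := MVT_segment at_ dft cf.
by rewrite mul0r => /eqP; rewrite subr_eq0 => /eqP.
Qed.

Lemma poly_antiderivative (q : {poly R}) :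
  exists2 p : {poly R}, (size p <= (size q).+1)%N & p^`() = q.
Proof.
exists (\poly_(i < (size q).+1) (q`_i.-1 / i%:R)); first exact: size_poly.
apply/polyP => i; rewrite coef_deriv coef_poly ltnS.
case: ltnP => [_|iq] /=; last by rewrite mul0rn nth_default.
by rewrite -[LHS]mulr_natr divfK// pnatr_eq0.
Qed.

(** By induction the derivative of [f] is a polynomial on the segment. An antiderivative of it
    differs from [f] by a constant, by the mean value theorem. *)
Lemma derive1n_eq0_poly n (f : R -> R) :
  (forall j (t : R), (j < n)%N -> t \in `[0, 1] ->
    is_derive t 1 (derive1n j f) (derive1n j.+1 f t)) ->
  (forall t : R, t \in `[0, 1] -> derive1n n f t = 0) ->
  exists2 p : {poly R}, (size p <= n)%N & {in `[0, 1], f =1 horner p}.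
Proof.
elim: n f => [|n IH] f df f0.
  by exists 0; rewrite ?size_poly0// => t t01; rewrite horner0 -(f0 t).
have [j t jn t01||q sq fq] := IH (derive1 f).
- by rewrite -!derive1Sn; exact: df.
- by move=> t t01; rewrite -derive1Sn f0.
have [p sp pq] := poly_antiderivative q.
have H : {in `[0, 1], forall t, (f - horner p) t = (f - horner p) 0}.
  apply: is_derive_0_segment_cst => t t01.
  have := df 0%N t isT t01; rewrite derive1n1 derive1n0 fq// => dft.
  by apply: is_derive_eq; rewrite pq subrr.
exists (p + (f 0 - p.[0])%:P).
  rewrite (leq_trans (size_polyD _ _))// geq_max (leq_trans sp)//=.
  by rewrite (leq_trans (size_polyC_leq1 _)).
move=> t t01; rewrite hornerD hornerC.
by have := H t t01; rewrite !fctE => <-; rewrite [RHS]addrC subrK.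
Qed.

End polynomial.

(** * Simultaneous Diophantine approximation *)

Section dirichlet.
Variable R : realType.

Lemma floor_frac (x : R) : 0 <= x - (Num.floor x)%:~R < 1.
Proof.
rewrite subr_ge0 floor_le /= ltrBlDr.
by have := floorD1_gt x; rewrite intrD addrC.
Qed.

(* Pigeonhole on the cells of side 1/N of the unit cube. *)
Lemma simultaneous_dirichlet (m N : nat) (alpha : 'I_m -> R) : (0 < N)%N ->
  exists2 q : nat, (0 < q <= N ^ m)%N &
    forall i, exists z : int, `|q%:R * alpha i - z%:~R| < N%:R^-1.
Proof.
move=> N0.
pose fr (q : nat) i : R := q%:R * alpha i - (Num.floor (q%:R * alpha i))%:~R.
have fr01 q i : 0 <= fr q i < 1 by exact: floor_frac.
have cellP q i : (Num.truncn (N%:R * fr q i) < N)%N.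
  have /andP[f0 f1] := fr01 q i.
  rewrite -(ltr_nat R); apply: (@le_lt_trans _ _ (N%:R * fr q i)).
    by rewrite truncn_le// mulr_ge0.
  by rewrite -[ltRHS]mulr1 ltr_pM2l// ltr0n.
pose cell (q : 'I_(N ^ m).+1) : {ffun 'I_m -> 'I_N} :=
  [ffun i => Ordinal (cellP q i)].
(* The [N ^ m + 1] multipliers [0, ..., N ^ m] fall into [N ^ m] cells, so two of them share a cell;
   their difference is the required [q]. *)
have /injectivePn[q1 [q2 q12 eq12]] : ~~ injectiveb cell.
  apply/negP => /injectiveP/leq_card.
  by rewrite card_ffun !card_ord ltnn.
wlog lt12 : q1 q2 q12 eq12 / (q1 < q2)%N.
  move=> H; have := q12; rewrite -val_eqE neq_ltn => /orP[lt|lt].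
    exact: (H q1 q2).
  by apply: (H q2 q1) => //; rewrite eq_sym.
exists (q2 - q1)%N.
  rewrite subn_gt0 lt12/= (leq_trans (leq_subr _ _))// -ltnS; exact: ltn_ord.
move=> i; exists (Num.floor (q2%:R * alpha i) - Num.floor (q1%:R * alpha i)).
have -> : (q2 - q1)%:R * alpha i -
    (Num.floor (q2%:R * alpha i) - Num.floor (q1%:R * alpha i))%:~R =
    fr q2 i - fr q1 i.
  by rewrite natrB ?(ltnW lt12)// intrB /fr; ring.
have N0' : 0 < N%:R :> R by rewrite ltr0n.
rewrite -(ltr_pM2l N0') divff ?gt_eqF//.
rewrite -[X in X * _]ger0_norm ?(ltW N0')// -normrM mulrBr.
have := congr1 (fun c : {ffun 'I_m -> 'I_N} => val (c i)) eq12; rewrite !ffunE /= => e.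
have tr (q : nat) : (Num.truncn (N%:R * fr q i))%:R <= N%:R * fr q i <
    (Num.truncn (N%:R * fr q i)).+1%:R.
  by apply: truncn_itv; rewrite mulr_ge0//; case/andP: (fr01 q i).
have := tr q1; have := tr q2; rewrite e -natr1 => /andP[? ?] /andP[? ?].
by rewrite ltr_norml; lra.
Qed.

End dirichlet.

(** * Cosine characters on the torus *)

Section torus.
Variable R : realType.
Local Notation "2pi" := (pi *+ 2 : R).

Lemma cosD2pi_int (x : R) (z : int) : cos (x + 2pi * z%:~R) = cos x.
Proof.
case: z => n; first by rewrite -pmulrn mulr_natr (periodicn (@cosD2pi R)).
rewrite NegzE mulrNz mulrN -pmulrn mulr_natr.
by rewrite -[in RHS](subrK (2pi *+ n.+1) x) (periodicn (@cosD2pi R)).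
Qed.

Lemma sinD2pi_int (x : R) (z : int) : sin (x + 2pi * z%:~R) = sin x.
Proof.
case: z => n; first by rewrite -pmulrn mulr_natr (periodicn (@sinD2pi R)).
rewrite NegzE mulrNz mulrN -pmulrn mulr_natr.
by rewrite -[in RHS](subrK (2pi *+ n.+1) x) (periodicn (@sinD2pi R)).
Qed.

Lemma Rintegral_cst01 (c : R) : Rintegral (@lebesgue_measure R) `[0, 1] (fun=> c) = c.
Proof.
by rewrite Rintegral_cst//= lebesgue_measure_itv/= lte01 EFinN sube0 mulr1.
Qed.

Lemma Rintegral_cos_period (c : R) (z : int) : z != 0 ->
  Rintegral (@lebesgue_measure R) `[0, 1] (fun t => cos (c + 2pi * z%:~R * t)) = 0.
Proof.
move=> z0; set w := 2pi * z%:~R.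
have w0 : w != 0.
  by rewrite mulf_neq0 ?intr_eq0// mulrn_eq0/= gt_eqF// pi_gt0.
(* This primitive takes equal values at 0 and 1, because [w] is an integer multiple of the
   period. *)
have dF (t : R) : is_derive t 1 (fun t => w^-1 * sin (c + w * t)) (cos (c + w * t)).
  have dl : is_derive t 1 (fun t : R => c + w * t) w.
    by apply: is_derive_eq; rewrite add0r mul1r [_ *: _]mulr1.
  have ds := @is_derive1_comp _ sin (fun t : R => c + w * t) t _ _ (is_derive_sin _) dl.
  have := @is_deriveZ _ _ _ _ w^-1 _ _ _ ds.
  by rewrite [_ *: (_ * _)]mulrCA mulVf// mulr1.
have cF (g dg : R -> R) :
    (forall t : R, is_derive t 1 g (dg t)) -> continuous g.
  by move=> H t; apply/differentiable_continuous/derivable1_diffP; exact: ex_derive.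
rewrite /Rintegral (@continuous_FTC2 _ _ (fun t => w^-1 * sin (c + w * t)))//=.
- by rewrite mulr1 mulr0 addr0 /w sinD2pi_int subrr.
- apply: continuous_subspaceT => t.
  apply: (@continuous_comp _ _ _ (fun t : R => c + w * t)); last exact: continuous_cos.
  by apply: cvgD; [exact: cvg_cst|apply: cvgM; [exact: cvg_cst|exact: cvg_id]].
- split.
  + by move=> t _; exact: ex_derive.
  + by apply: cvg_at_right_filter; exact: (cF _ _ dF).
  + by apply: cvg_at_left_filter; exact: (cF _ _ dF).
- by move=> t _; rewrite derive1E derive_val.
Qed.

Lemma cube_int_eq (m : nat) (G1 G2 : (nat -> R) -> R) :
  G1 =1 G2 -> cube_int m G1 = cube_int m G2.
Proof. by move=> /funext ->. Qed.

(** The free phase [c] makes the induction work: the outermost variable is fixed during the inner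
    integrals, so its contribution is absorbed into the phase. *)
Lemma cube_int_cos (m : nat) (h : nat -> int) (c : R) :
  cube_int m (fun x => cos (c + 2pi * \sum_(i < m) (h i)%:~R * x i)) =
  if [forall i : 'I_m, h i == 0] then cos c else 0.
Proof.
elim: m c => [|m IH] c /=.
  rewrite big_ord0 mulr0 addr0; case: forallP => // -[] [] //.
transitivity (Rintegral (@lebesgue_measure R) `[0, 1] (fun t =>
    if [forall i : 'I_m, h i == 0] then cos (c + 2pi * (h m)%:~R * t) else 0)).
  congr Rintegral; apply/funext => t; rewrite -IH; apply: cube_int_eq => x.
  congr cos; rewrite big_ord_recr/= eqxx.
  under eq_bigr => i _ do rewrite ltn_eqF//.
  by ring.
have -> : [forall i : 'I_m.+1, h i == 0] = [forall i : 'I_m, h i == 0] && (h m == 0).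
  apply/forallP/andP => [H|[/forallP H hm] i].
    split; last exact: (H ord_max).
    by apply/forallP => i; exact: (H (widen_ord (leqnSn m) i)).
  have := ltn_ord i; rewrite ltnS leq_eqVlt => /orP[/eqP->//|im].
  exact: (H (Ordinal im)).
case: [forall i : 'I_m, h i == 0] => /=; last exact: Rintegral_cst01.
case: eqVneq => [->|hm]; last exact: Rintegral_cos_period.
rewrite -[RHS]Rintegral_cst01; congr Rintegral; apply/funext => t.
by rewrite mulr0 mul0r addr0.
Qed.

(** The real part of the character of frequency [h], used as a real-valued test function. *)
Definition character_cos {d} (h : 'rV[int]_d) (x : 'rV[R]_d) : R :=
  cos (2pi * \sum_(i < d) (h ord0 i)%:~R * x ord0 i).

Lemma torus_int_character_cos d (h : 'rV[int]_d) : h != 0 ->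
  torus_int (character_cos h) = 0.
Proof.
(* In dimension 0 no [h] is nonzero; in positive dimension [inord] extends [h] to all natural
   indices. *)
case: d h => [|d] h h0; first by rewrite (thinmx0 h) eqxx in h0.
pose hn (i : nat) := h ord0 (inord i).
have := cube_int_cos d.+1 hn 0.
have -> : [forall i : 'I_d.+1, hn i == 0] = false.
  apply/negbTE; apply: contra h0 => /forallP H.
  apply/eqP/rowP => i; rewrite mxE; apply/eqP.
  by have := H i; rewrite /hn inord_val.
move=> <-; apply: cube_int_eq => x; rewrite /character_cos add0r.
congr (cos (_ * _)); apply: eq_bigr => i _.
by rewrite mxE /hn inord_val.
Qed.

Lemma periodic_character_cos d (h : 'rV[int]_d) : Defs.periodic (character_cos h).
Proof.
move=> x v; rewrite /character_cos.
rewrite -[RHS](cosD2pi_int _ (\sum_(i < d) h ord0 i * v ord0 i)).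
congr cos; rewrite -mulrDr; congr (_ * _).
rewrite raddf_sum -big_split/=; apply: eq_bigr => i _.
by rewrite !mxE mulrDr intrM.
Qed.

Lemma continuous_character_cos d (h : 'rV[int]_d) : continuous (character_cos h).
Proof.
move=> x; rewrite /character_cos.
apply: (@continuous_comp _ _ _ (fun x : 'rV[R]_d =>
    2pi * \sum_(i < d) (h ord0 i)%:~R * x ord0 i));
  last exact: continuous_cos.
apply: (@cvgM _ _ (nbhs x) _ (fun=> 2pi)); first exact: cvg_cst.
apply: cvg_big => [|i _]; first exact: add_continuous.
apply: (@cvgM _ _ (nbhs x) _ (fun=> (h ord0 i)%:~R)); first exact: cvg_cst.
exact: coord_continuous.
Qed.

Lemma cos_near_int : exists2 e : R, 0 < e & forall (x : R) (z : int),
  `|x - z%:~R| < e -> 1 / 2 < cos (2pi * x).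
Proof.
have : \forall u \near (0 : R), 1 / 2 < cos u.
  apply: (cvgr_gt _ (@continuous_cos R 0)).
  by rewrite cos0; lra.
move=> /nbhs_ballP[e /= e0 he].
have p0 : 0 < 2pi by rewrite pmulrn_lgt0// pi_gt0.
exists (e / 2pi); first by rewrite divr_gt0.
move=> x z xz; rewrite -(subrK (z%:~R) x) mulrDr cosD2pi_int.
apply: he; rewrite -ball_normE/= sub0r normrN normrM gtr0_norm//.
by rewrite mulrC -ltr_pdivlMr.
Qed.

End torus.
Arguments character_cos {R d}.

(** * Scaling polynomial samples close to integers *)

Lemma poly_samples_near_int (R : realType) (p : {poly R}) (kappa : nat) (e : R) :
  (size p <= kappa.+1)%N -> 0 < e ->
  exists2 n0 : nat, (0 < n0)%N & forall n : nat, (n0 <= n)%N ->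
    exists2 rho : R, n%:R ^+ kappa <= rho <= n%:R ^+ ((kappa + 1) ^ 2) &
      forall k : nat, (k <= n)%N ->
        exists z : int, `|rho * p.[k%:R / n%:R] - z%:~R| < e.
Proof.
move=> sp e0.
(* Each of the [kappa.+1] monomials will contribute an error of at most [1 / C], so the total stays
   below [e]. *)
have [C C0 hC] : exists2 C : nat, (0 < C)%N & kappa.+1%:R < e * C%:R.
  exists (Num.bound (kappa.+1%:R / e)).
    rewrite -(ltr_nat R); apply: le_lt_trans (archi_boundP _); rewrite divr_ge0// ltW//.
  by rewrite mulrC -ltr_pdivrMr// archi_boundP// divr_ge0// ltW.
exists (C ^ kappa.+1)%N; first by rewrite expn_gt0 C0.
move=> n hn.
have n0 : (0 < n)%N by apply: leq_trans hn; rewrite expn_gt0 C0.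
have n0R : n%:R != 0 :> R by rewrite pnatr_eq0 -lt0n.
pose N := (C * n ^ kappa)%N.
have N0 : (0 < N)%N by rewrite muln_gt0 C0 expn_gt0 n0.
pose alpha (j : 'I_kappa.+1) : R := p`_j * n%:R ^+ (kappa - j).
have [q /andP[q0 qN] hq] := @simultaneous_dirichlet R _ N alpha N0.
have [z hz] := choice hq.
exists (n ^ kappa * q)%:R.
  rewrite -!natrX !ler_nat leq_pmulr//=.
  apply: (@leq_trans (n ^ kappa * N ^ kappa.+1)); first by rewrite leq_mul2l qN orbT.
  rewrite /N expnMn mulnCA -expnM -expnD.
  (* One factor [n] pays for [C ^ kappa.+1], and [1 + kappa + kappa * (kappa + 1)] equals
     [(kappa + 1) ^ 2]. *)
  apply: (@leq_trans (n ^ 1 * n ^ (kappa + kappa * kappa.+1))).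
    by rewrite expn1 leq_mul2r hn orbT.
  by rewrite -expnD leq_pexp2l//; lia.
move=> k kn; exists (\sum_(j < kappa.+1) z j * k%:Z ^+ j).
rewrite (horner_coef_wide _ sp) mulr_sumr raddf_sum -sumrB/=.
have term (j : 'I_kappa.+1) : `|(n ^ kappa * q)%:R * (p`_j * (k%:R / n%:R) ^+ j) -
    (z j * k%:Z ^+ j)%:~R| <= C%:R^-1.
  have -> : (n ^ kappa * q)%:R * (p`_j * (k%:R / n%:R) ^+ j) - (z j * k%:Z ^+ j)%:~R =
      (q%:R * alpha j - (z j)%:~R) * k%:R ^+ j.
    rewrite /alpha intrM rmorphXn/= natrM natrX -pmulrn.
    have -> : n%:R ^+ kappa = n%:R ^+ (kappa - j) * n%:R ^+ j :> R.
      by rewrite -exprD subnK// -ltnS.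
    by rewrite exprMn exprVn; field; rewrite expf_neq0.
  rewrite normrM normrX normr_nat.
  (* The approximation error below [1 / N] is magnified by [k ^ j <= n ^ kappa], which the factor
     [n ^ kappa] in [N] cancels. *)
  apply: (@le_trans _ _ (N%:R^-1 * n%:R ^+ kappa)).
    apply: ler_pM => //; first exact: ltW.
    apply: (@le_trans _ _ (n%:R ^+ j)); first by rewrite lerXn2r ?nnegrE// ler_nat.
    by rewrite ler_weXn2l ?ler1n// -ltnS.
  by rewrite /N natrM natrX invfM -mulrA mulVf ?mulr1// expf_neq0.
apply: (le_lt_trans (ler_norm_sum _ _ _)).
apply: (@le_lt_trans _ _ (\sum_(j < kappa.+1) C%:R^-1)); first exact: ler_sum.
by rewrite sumr_const card_ord -[ltLHS]mulr_natl ltr_pdivrMr// ltr0n.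
Qed.

(** * Failure of equidistribution *)

Lemma character_cos_scale (R : realType) d (h : 'rV[int]_d) (r : R) (x : 'rV[R]_d) :
  character_cos h (r *: x) =
  cos ((pi *+ 2) * (r * \sum_(i < d) (h ord0 i)%:~R * x ord0 i)).
Proof.
rewrite /character_cos; congr (cos (_ * _)); rewrite mulr_sumr.
by apply: eq_bigr => i _; rewrite mxE mulrCA.
Qed.

Theorem theorem1p3 (R : realType) (d : nat) (gamma : R -> 'rV[R]_d)
  (kappa : nat) :
  analytic_curve gamma -> rat_nondeg_order gamma kappa ->
  exists rho : nat -> R,
    (forall n : nat, (0 < n)%N ->
       (n%:R) ^+ kappa <= rho n <= (n%:R) ^+ ((kappa + 1) ^ 2)) /\
    ~ equidistributes (mu rho gamma).
Proof.
move=> [U [oU [U01 aU]]] [_ [_ kmax]].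
(* If no such [h] existed, the curve would be non-degenerate at order [kappa.+1], against
   maximality. *)
have [h h0 hdeg] : exists2 h : 'rV[int]_d, h != 0 & forall t : R, t \in `[0, 1] ->
    \sum_(i < d) (h ord0 i)%:~R * curve_deriv kappa.+1 gamma t ord0 i = 0.
  apply: contrapT => H.
  suff /(kmax kappa.+1 isT) : nondeg_at gamma kappa.+1 by rewrite ltnn.
  move=> h h0; apply: contrapT => Hh; apply: H; exists h => // t t01.
  by apply/eqP; apply: contrapT => /negP ne; apply: Hh; exists t.
pose f (t : R) := \sum_(i < d) (h ord0 i)%:~R * gamma t ord0 i.
have Ut (t : R) : t \in `[0, 1] -> U t by move=> t01; apply: U01.
have der n (t : R) : t \in `[0, 1] -> is_derive t 1 (derive1n n f) (derive1n n.+1 f t) /\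
    derive1n n f t = \sum_(i < d) (h ord0 i)%:~R * derive1n n (fun s => gamma s ord0 i) t.
  move=> /Ut; exact: (@derive1n_lincomb R d (fun i => (h ord0 i)%:~R)
    (fun i s => gamma s ord0 i) U n oU aU).
have [p sp fp] : exists2 p : {poly R}, (size p <= kappa.+1)%N &
    {in `[0, 1], f =1 horner p}.
  apply: (@derive1n_eq0_poly R kappa.+1 f) => [j t _ t01|t t01].
    by have [] := der j t t01.
  have [_ ->] := der kappa.+1 t t01.
  rewrite -[RHS](hdeg t t01); apply: eq_bigr => i _.
  by rewrite mxE.
have [e e0 cos_e] := cos_near_int R.
have [n0 n00 Hn0] := @poly_samples_near_int R p kappa e sp e0.
have /choice[rho Hrho] : forall n : nat, exists r : R, (0 < n)%N ->
    (n%:R ^+ kappa <= r <= n%:R ^+ ((kappa + 1) ^ 2)) /\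
    ((n0 <= n)%N -> forall k : nat, (k <= n)%N ->
        exists z : int, `|r * p.[k%:R / n%:R] - z%:~R| < e).
  move=> n; have [/Hn0[r Hr Hk]|nn0] := leqP n0 n; first by exists r.
  (* Below [n0] only the growth bounds are required, so the lower bound itself serves as [rho n]. *)
  exists (n%:R ^+ kappa) => n_gt0; split => //.
  by rewrite lexx/= ler_weXn2l ?ler1n//; lia.
exists rho; split; first by move=> n /Hrho[].
move=> /(_ _ (continuous_character_cos R d h) (periodic_character_cos R d h)).
(* Equidistribution would bring the averages strictly below 1/2 for large indices; an index beyond
   both [n0] and [n1] contradicts this, as every sampled cosine there exceeds 1/2. *)
rewrite torus_int_character_cos// => /cvgrPdist_lt/(_ (1/2)) [//|].
move=> n1 _ /(_ (maxn n0 n1) (leq_maxr _ _)) /=.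
set n := maxn n0 n1; have n0n : (n0 <= n)%N by exact: leq_maxl.
have n_gt0 : (0 < n)%N by exact: leq_trans n0n.
have nR : 0 < n%:R :> R by rewrite ltr0n.
have [_ /(_ n0n) Hk] := Hrho n n_gt0.
suff : 1 / 2 <= mu rho gamma n (character_cos h).
  move=> half; rewrite sub0r normrN ger0_norm; last by apply: le_trans half; lra.
  by move=> /(le_lt_trans half); rewrite ltxx.
rewrite /mu [leRHS]mulrC ler_pdivlMr//.
have -> : 1 / 2 * n%:R = \sum_(1 <= k < n.+1) (1 / 2 : R).
  by rewrite big_const_nat iter_addr_0 subn1/= mulr_natr.
apply: ler_sum_nat => k; rewrite ltnS => /andP[_ kn].
rewrite character_cos_scale -/(f _) fp.
  by have [z /cos_e/ltW] := Hk k kn.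
by rewrite in_itv/= divr_ge0//= ler_pdivrMr// mul1r ler_nat.
Qed.
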